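(* In the setting of the context (a weighted genus two admissible cover over the standard log point, with associated function $\lambda$ and degree one effective divisor $D$ on the tree $\Delta_T$), suppose $D=\tfrac12(D_1+D_2)$ for two distinct points $D_1,D_2$ of $\Delta_T$. Let $e$ be any edge of $\Delta_T$ lying between $D_1$ and $D_2$, with interior $e^\circ$. Then each of the connected components of $\mathrm{trop}(\psi)^{-1}(\Delta_T\setminus e^\circ)$ has genus one.
   Context: *Admissible cover.* Over $\mathbb C$, let $\psi\colon(C,D_R)\to(T,D_B)$ be a hyperelliptic admissible cover: a finite degree two morphism of nodal curves, $C$ connected of arithmetic genus $2$, $T$ of genus $0$, étale on $C^{sm}\setminus D_R$, simply ramified along the six smooth points $D_R$ mapping to six distinct smooth points $D_B$, mapping nodes to nodes with the same ramification order $1$ or $2$ on both branches. It carries a weight $w\colon V(\Gamma)\to\mathbb N$ on the dual graph of $C$, not identically zero, such that with $w_T(v)=\sum_{v'\mapsto v}w(v')$ every component of $T$ with $w_T=0$ has at least three nodes or branch points. *Metric.* $\Gamma=\mathrm{trop}(C)$ and the tree $\Gamma_T=\mathrm{trop}(T)$ are the dual graphs with positive real edge lengths, where the length of an edge of $\Gamma_T$ is the ramification order (expansion factor) times the length of any edge of $\Gamma$ above it; $\mathrm{trop}(\psi)\colon\Gamma\to\Gamma_T$ is the induced harmonic map of degree two. For a subcurve, genus means arithmetic genus: first Betti number plus sum of vertex genera. *Functions.* A piecewise linear (PL) function has integral slopes on (a subdivision of) $\Gamma$ (half-integral slopes allowed on $\Gamma_T$); $\mathrm{div}(\lambda)(v)$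 is the sum of outgoing slopes at $v$; $K_\Gamma(v)=2g(v)-2+\mathrm{val}(v)$. Pullback along $\mathrm{trop}(\psi)$ composes functions and multiplies divisors by local degrees. On $\Gamma_T$ let $D'(v)=\mathrm{val}(v)-2+\tfrac12\deg(D_B|_v)$ (valence counts edges only); it has degree $1$ and pulls back to $K_\Gamma$. For each vertex $v_0$ of $\Gamma_T$ there is a PL function $\overline\lambda_T$, unique up to constants, with $D'+\mathrm{div}(\overline\lambda_T)=v_0$; its pullback to $\Gamma$ is an *admissible function*. Let $\overline\lambda_1,\dots,\overline\lambda_s$ be all of them and let $\lambda_i$ be $\overline\lambda_i$ shifted by a constant so that vertices with $\lambda_i>0$ have weight $0$ while those with $\lambda_i\ge0$ have total weight $\ge1$ (i.e. the maximum of $\lambda_i$ on vertices of positive weight is $0$). Define $\lambda=\max\{0,\lambda_1,\dots,\lambda_s\}$, a PL function on a subdivision of $\Gamma$, pulled back from $\lambda_T$ on $\Gamma_T$. Put $\Delta^\circ=\{\lambda>0\}$ and let $\Delta$ be the minimal subcurve of genus two containing the closure of $\Delta^\circ$, $\Delta_T$ its image in $\Gamma_T$. With $D'$ computed using valences in $\Delta_T$, $D=D'+\mathrm{div}(\lambda_T)$ is an effective divisor of degree $1$ with half-integral coefficients on $\Delta_T$ (a point, or half the sum of two points in the locus of expansion factor $2$) and $\mathrm{trop}(\psi)^*D=K_\Delta+\mathrm{div}(\lambda)$ on $\Delta$. *)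

(* Defs.v *)
From HB Require Import structures.
From mathcomp Require Import all_boot all_order all_algebra.
From mathcomp Require Import reals.

Set Implicit Arguments.
Unset Strict Implicit.
Unset Printing Implicit Defensive.

Import Order.TTheory GRing.Theory Num.Theory.
Local Open Scope ring_scope.

(* The orientation of an edge is auxiliary: it only serves to give coordinates
   on the edge.  Loops and multiple edges are allowed. *)
Record graph := Graph {
  vert : finType;
  edge : finType;
  src : edge -> vert;
  tgt : edge -> vert;
  vgenus : vert -> nat
}.

Record subgraph (G : graph) := Subgraph {
  sverts : {set vert G};
  sedges : {set edge G}
}.

Section Subgraphs.
Variable G : graph.
Implicit Types (H K : subgraph G) (u v : vert G) (e : edge G).

Definition closed_subgraph H : Prop :=
  forall e, e \in sedges H -> src e \in sverts H /\ tgt e \in sverts H.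

Definition sub_subgraph H K : Prop :=
  sverts H \subset sverts K /\ sedges H \subset sedges K.

Definition full_subgraph : subgraph G := Subgraph [set: vert G] [set: edge G].

Definition adj H : rel (vert G) := fun u v =>
  [exists e in sedges H, ((src e == u) && (tgt e == v))
                      || ((src e == v) && (tgt e == u))].

Definition connected H : Prop :=
  sverts H != set0
  /\ forall u v, u \in sverts H -> v \in sverts H -> connect (adj H) u v.

Definition component H v : subgraph G :=
  let A := [set u in sverts H | connect (adj H) v u] in
  Subgraph A [set e in sedges H | src e \in A].

Definition betti1 H : int :=
  (#|sedges H|)%:Z - (#|sverts H|)%:Z + (n_comp (adj H) (sverts H))%:Z.

Definition genus H : int :=
  betti1 H + (\sum_(v in sverts H) vgenus v)%N%:Z.

(* A loop contributes 2. *)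
Definition incid e v : nat := ((src e == v) + (tgt e == v))%N.

Definition valence H v : nat := (\sum_(e in sedges H) incid e v)%N.

(* H minus the interior of the edge e. *)
Definition remove_edge H e : subgraph G :=
  Subgraph (sverts H) (sedges H :\ e).

(* When H is a tree: e belongs to the path joining u and v in H. *)
Definition between H e u v : Prop :=
  e \in sedges H /\ ~~ connect (adj (remove_edge H e)) u v.

End Subgraphs.

Definition image_subgraph (G G' : graph) (fV : vert G -> vert G')
    (fE : edge G -> edge G') (H : subgraph G) : subgraph G' :=
  Subgraph (fV @: sverts H) (fE @: sedges H).

Definition preimage_subgraph (G G' : graph) (fV : vert G -> vert G')
    (fE : edge G -> edge G') (H : subgraph G') : subgraph G :=
  Subgraph (fV @^-1: sverts H) (fE @^-1: sedges H).

Section Slopes.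
Variables (R : realType) (G : graph) (len : edge G -> R).

(* Slope of f along e, from src e to tgt e. *)
Definition slope (f : vert G -> R) (e : edge G) : R :=
  (f (tgt e) - f (src e)) / len e.

(* Sum of the outgoing slopes of f at v along the edges of H. *)
Definition div (f : vert G -> R) (H : subgraph G) (v : vert G) : R :=
  \sum_(e in sedges H) ((src e == v)%:R - (tgt e == v)%:R) * slope f e.

End Slopes.

(* The combinatorial type of a weighted admissible cover psi : C -> T.
   Vertices of [Gam] and [Tree] are components of C and T, edges are nodes;
   [cmE e] is the common ramification order at the two branches of the node e,
   [cdeg v] is the degree of psi on the component v, and [cram i] is the
   component carrying the i-th ramification point. *)
Record admissible_cover (R : realType) := AdmissibleCover {
  Gam : graph;
  Tree : graph;
  lenG : edge Gam -> R;
  lenT : edge Tree -> R;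
  cV : vert Gam -> vert Tree;
  cE : edge Gam -> edge Tree;
  cmE : edge Gam -> nat;
  cdeg : vert Gam -> nat;
  cram : 'I_6 -> vert Gam;
  cw : vert Gam -> nat;

  lenG_gt0 : forall e, 0 < lenG e;
  lenT_gt0 : forall e, 0 < lenT e;

  Gam_connected : connected (full_subgraph Gam);
  Gam_genus : genus (full_subgraph Gam) = 2;
  Tree_connected : connected (full_subgraph Tree);
  Tree_genus : genus (full_subgraph Tree) = 0;

  cE_src : forall e, src (cE e) = cV (src e);
  cE_tgt : forall e, tgt (cE e) = cV (tgt e);
  cmE_12 : forall e, cmE e = 1%N \/ cmE e = 2%N;
  cE_len : forall e, lenT (cE e) = (cmE e)%:R * lenG e;

  cdeg_gt0 : forall v, (0 < cdeg v)%N;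
  cdeg_total : forall v, (\sum_(v' | cV v' == v) cdeg v' = 2)%N;
  harmonic_src : forall v e, src e = cV v ->
    (\sum_(e' | (cE e' == e) && (src e' == v)) cmE e' = cdeg v)%N;
  harmonic_tgt : forall v e, tgt e = cV v ->
    (\sum_(e' | (cE e' == e) && (tgt e' == v)) cmE e' = cdeg v)%N;

  cram_deg : forall i, cdeg (cram i) = 2%N;

  (* 2 g(v) - 2 = - 2 deg(v) + (ramification on v): since T has genus 0 this
     expresses that psi is etale away from the nodes and the points of D_R,
     and simply ramified along D_R. *)
  Riemann_Hurwitz : forall v,
    (2 * vgenus v + 2 * cdeg v
     = 2 + #|[set i | cram i == v]| + \sum_e incid e v * (cmE e).-1)%N;

  cw_neq0 : exists v, cw v <> 0%N;
  stability : forall v,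
    (\sum_(v' | cV v' == v) cw v' = 0)%N ->
    (3 <= valence (full_subgraph Tree) v + #|[set i | cV (cram i) == v]|)%N
}.

Section Cover.
Variables (R : realType) (X : admissible_cover R).
Local Notation VT := (vert (Tree X)).
Local Notation ET := (edge (Tree X)).

(* Expansion factor 2; by harmonicity there is then a single edge above e. *)
Definition ramified (e : ET) : bool :=
  [exists e', (cE e' == e) && (cmE e' == 2%N)].

Definition branch_deg (v : VT) : nat := #|[set i : 'I_6 | cV (cram X i) == v]|.

End Cover.

(* val(v) - 2 + 1/2 deg(D_B|_v), relative to a subtree H.  The branch points of
   the restriction of the cover to H are the points of D_B lying on H together
   with the ramified nodes at which H is cut off from the rest of the tree, so
   both enter deg(D_B|_v); with this convention the pullback is the canonical
   divisor of the preimage of H.  There is no correction if H is everything. *)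
Definition Dprime (R : realType) (G : graph) (ram : pred (edge G))
    (br : vert G -> nat) (H : subgraph G) (v : vert G) : R :=
  (valence H v)%:R - 2
  + (br v + \sum_(e | (e \notin sedges H) && ram e) incid e v)%N%:R / 2.

Section AdmissibleFunctions.
Variables (R : realType) (X : admissible_cover R).
Local Notation VT := (vert (Tree X)).
Local Notation ET := (edge (Tree X)).

(* f is given by its values on vertices and is linear on edges: the equation
   D' + div f = v0 leaves no room for bends inside the edges. *)
Definition is_admissible (v0 : VT) (f : VT -> R) : Prop :=
  (forall e : ET, exists k : int, slope (@lenT R X) f e = k%:~R / 2)
  /\ forall v : VT,
       Dprime R (@ramified R X) (@branch_deg R X) (full_subgraph (Tree X)) v
       + div (@lenT R X) f (full_subgraph (Tree X)) v = (v == v0)%:R.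

Definition is_normalized (f : VT -> R) : Prop :=
  (forall v : vert (Gam X), 0 < f (cV v) -> cw v = 0%N)
  /\ (1 <= \sum_(v : vert (Gam X) | (0 <= f (cV v))%R) cw v)%N.

Variable lam : VT -> VT -> R.

(* lambda_T = max {0, lambda_1, ..., lambda_s}, at a vertex and at the point of
   the edge e at distance t from src e. *)
Definition lamT_vert (v : VT) : R := \big[Num.max/0]_(v0 : VT) lam v0 v.

Definition lamT_edge (e : ET) (t : R) : R :=
  \big[Num.max/0]_(v0 : VT)
    (lam v0 (src e) + slope (@lenT R X) (lam v0) e * t).

End AdmissibleFunctions.

Section SubdividedGraph.
Variables (G : graph) (n : edge G -> nat).

(* The i-th of the (n e).+2 vertices found along e, from src e to tgt e. *)
Definition sd_node (e : edge G) (i : nat)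
    : (vert G + {e : edge G & 'I_(n e)})%type :=
  if i is j.+1 then
    if insub j is Some k then inr (existT (fun e => 'I_(n e)) e k)
    else inl (tgt e)
  else inl (src e).

(* Each edge e is divided into (n e).+1 edges by n e vertices of genus 0. *)
Definition sd_graph : graph := @Graph
  (vert G + {e : edge G & 'I_(n e)})%type
  {e : edge G & 'I_(n e).+1}
  (fun x => sd_node (tag x) (tagged x))
  (fun x => sd_node (tag x) (tagged x).+1)
  (fun v => if v is inl v then vgenus v else 0%N).

End SubdividedGraph.

Section SubdividedMap.
Variables (G G' : graph) (fV : vert G -> vert G') (fE : edge G -> edge G').
Variable n : edge G' -> nat.

Definition sd_mapV (v : vert (sd_graph (fun e : edge G => n (fE e))))
    : vert (sd_graph n) :=
  match v with
  | inl v => inl (fV v)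
  | inr (existT e k) => inr (existT (fun e => 'I_(n e)) (fE e) k)
  end.

Definition sd_mapE (x : edge (sd_graph (fun e : edge G => n (fE e))))
    : edge (sd_graph n) :=
  existT (fun e => 'I_(n e).+1) (fE (tag x)) (tagged x).

End SubdividedMap.

(* Coordinates of the (n e).+2 vertices along e. *)
Definition knot_of (R : realType) (G : graph) (len : edge G -> R)
    (n : edge G -> nat) (pos : forall e, 'I_(n e) -> R)
    (e : edge G) (i : nat) : R :=
  if i is j.+1 then if insub j is Some k then pos e k else len e else 0.

(* A subdivision of the tree; Gam is subdivided by the preimages of the new
   vertices. *)
Record subdivision (R : realType) (X : admissible_cover R) := Subdivision {
  sd_n : edge (Tree X) -> nat;
  sd_pos : forall e : edge (Tree X), 'I_(sd_n e) -> R;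
  sd_incr : forall (e : edge (Tree X)) (i : nat), (i <= sd_n e)%N ->
    knot_of (@lenT R X) sd_pos e i < knot_of (@lenT R X) sd_pos e i.+1
}.

Section Delta.
Variables (R : realType) (X : admissible_cover R).
Local Notation VT := (vert (Tree X)).
Variables (lam : VT -> VT -> R) (S : subdivision X).

Definition sdT : graph := sd_graph (@sd_n R X S).
Definition sdG : graph := sd_graph (fun e : edge (Gam X) => sd_n S (cE e)).
Definition psiV : vert sdG -> vert sdT := @sd_mapV _ _ (@cV R X) _ _.
Definition psiE : edge sdG -> edge sdT := @sd_mapE _ _ (@cE R X) _.

Definition knot : edge (Tree X) -> nat -> R :=
  knot_of (@lenT R X) (@sd_pos R X S).
Definition sd_left (x : edge sdT) : R := knot (tag x) (tagged x).
Definition sd_right (x : edge sdT) : R := knot (tag x) (tagged x).+1.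
Definition sd_len (x : edge sdT) : R := sd_right x - sd_left x.

Definition sd_ramified : pred (edge sdT) := fun x => ramified (tag x).
Definition sd_branch_deg (v : vert sdT) : nat :=
  if v is inl v then branch_deg v else 0%N.

Definition sd_lamT (v : vert sdT) : R :=
  match v with
  | inl v => lamT_vert lam v
  | inr (existT e k) => lamT_edge lam e (sd_pos k)
  end.

Definition lamT_linear : Prop :=
  forall x : edge sdT, exists a c : R, forall t : R,
    sd_left x <= t <= sd_right x -> lamT_edge lam (tag x) t = c + a * t.

(* A closed subgraph contains {lambda > 0} iff it contains its closure. *)
Definition contains_lam_pos (H : subgraph sdG) : Prop :=
  (forall v, 0 < sd_lamT (psiV v) -> v \in sverts H)
  /\ (forall x t, sd_left (psiE x) < t < sd_right (psiE x) ->
        0 < lamT_edge lam (tag (psiE x)) t -> x \in sedges H).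

Definition genus_two_subcurve (H : subgraph sdG) : Prop :=
  [/\ closed_subgraph H, connected H, genus H = 2 & contains_lam_pos H].

Definition is_Delta (H : subgraph sdG) : Prop :=
  genus_two_subcurve H
  /\ forall K, genus_two_subcurve K -> sub_subgraph H K.

Definition psi_image : subgraph sdG -> subgraph sdT := image_subgraph psiV psiE.
Definition psi_preimage : subgraph sdT -> subgraph sdG :=
  preimage_subgraph psiV psiE.

Definition divD (DT : subgraph sdT) (v : vert sdT) : R :=
  Dprime R sd_ramified sd_branch_deg DT v + div sd_len sd_lamT DT v.

End Delta.

(* Main.v *)
(* Let A be the part of Delta_T \ e on one side of e, and b the number of branch
   points on A, counting the ramified nodes where Delta_T is cut off from the
   tree.  As D has degree 1/2 on A, the slope of lambda_T along e, directed away
   from A, is (3 - b)/2.  By Riemann-Hurwitz, b is odd iff e is ramified, so this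
   slope is integral iff e is ramified.  On the other hand lambda_T is linear on
   e, so its slope is either 0 or the slope of some lambda_i, and the same count
   on the whole tree shows that the latter is integral iff e is unramified.
   Hence the slope is 0, b = 3 and e is ramified: the preimage of A is a
   connected double cover of a tree with 4 branch points, so it has genus 1. *)

Require Import Defs.
From HB Require Import structures.
From mathcomp Require Import all_boot all_order all_algebra.
From mathcomp Require Import reals.
From mathcomp Require Import zify ring lra.
Import Order.TTheory GRing.Theory Num.Theory.
Local Open Scope ring_scope.

Set Implicit Arguments.
Unset Strict Implicit.
Unset Printing Implicit Defensive.

(** * Connectivity and Euler counts for subgraphs and trees *)

Lemma sum_eq_mem (I : finType) (W : {set I}) u :
  (\sum_(v in W) (u == v) = (u \in W))%N.
Proof.
rewrite big_mkcond (bigD1 u) //= eqxx big1 ?addn0 => [|v /negPf uv].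
  by case: (u \in W).
by rewrite eq_sym uv; case: (v \in W).
Qed.

Section Graphs.
Variable G : graph.
Implicit Types (H K : subgraph G) (u v w : vert G) (e x : edge G).
Implicit Type W : {set vert G}.

Lemma adj_sym H : symmetric (adj H).
Proof. by move=> u v; apply: eq_existsb => e; rewrite orbC. Qed.

Lemma connect_adj_sym H : connect_sym (adj H).
Proof. exact/sym_connect_sym/adj_sym. Qed.

Lemma adj_src_tgt H x : x \in sedges H -> adj H (src x) (tgt x).
Proof. by move=> Hx; apply/existsP; exists x; rewrite Hx !eqxx. Qed.

Lemma crossing_edge H W u v :
  connect (adj H) u v -> u \in W -> v \notin W ->
  exists2 x, x \in sedges H & (src x \in W) != (tgt x \in W).
Proof.
case/connectP=> p; elim: p u => [|w p IHp] u /=; first by move=> _ -> ->.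
case/andP=> /existsP[x /andP[Hx uw]] pwp vE uW vW.
have [wW|wW] := boolP (w \in W); first exact: IHp pwp vE wW vW.
exists x => //.
by case/orP: uw => /andP[/eqP-> /eqP->]; rewrite uW (negPf wW).
Qed.

Lemma connect_sverts H u v :
  closed_subgraph H -> u \in sverts H -> connect (adj H) u v ->
  v \in sverts H.
Proof.
move=> clH uH uv; apply: contraT => vH.
have [x /clH[-> ->]] := crossing_edge uv uH vH.
by rewrite eqxx.
Qed.

(** Induction on the number of vertices still outside [W]: connectedness gives an edge crossing the
    boundary of [W], and absorbing its outer end uses up that edge, which from then on lies inside
    [W]. *)
Lemma card_sverts_outside K W :
  closed_subgraph K -> connected K -> W \subset sverts K -> W != set0 ->
  (#|sverts K :\: W| <=
     #|[set x in sedges K | ~~ ((src x \in W) && (tgt x \in W))]|)%N.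
Proof.
move=> clK [_ conK]; move n_def: #|sverts K :\: W| => n.
elim: n W n_def => // n IHn W n_def sWK nzW.
have /card_gt0P[v] : (0 < #|sverts K :\: W|)%N by rewrite n_def.
rewrite inE => /andP[vW vK]; have [u uW] := set0Pn _ nzW.
have [x xK xW] := crossing_edge (conK u v (subsetP sWK u uW) vK) uW vW.
have [sxK txK] := clK x xK.
(* [w] is the end of the crossing edge outside [W]. *)
pose w := if src x \in W then tgt x else src x.
have wK : w \in sverts K by rewrite /w; case: ifP.
have wW : w \notin W.
  by rewrite /w; case: ifP xW => [_|/negbT //]; case: (_ \in W).
have xwW : (src x \in w |: W) && (tgt x \in w |: W).
  rewrite !inE /w; case: ifP xW => /= _; rewrite eqxx ?orbT //.
  by case: (_ \in W); rewrite ?orbT.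
apply: leq_ltn_trans (IHn (w |: W) _ _ _) _.
- have -> : sverts K :\: (w |: W) = (sverts K :\: W) :\ w.
    by apply/setP=> z; rewrite !inE negb_or andbA.
  by have := cardsD1 w (sverts K :\: W); rewrite !inE wK wW n_def add1n => -[->].
- by rewrite subUset sub1set wK.
- by apply/set0Pn; exists w; rewrite !inE eqxx.
apply: proper_card; apply/properP; split.
  apply/subsetP=> z; rewrite !inE => /andP[-> /=]; apply: contra => /andP[-> ->].
  by rewrite !orbT.
exists x; rewrite !inE ?xK.
  by move: xW; case: (_ \in W); case: (_ \in W).
by move: xwW; rewrite !inE => ->.
Qed.

Lemma card_sverts_connected K :
  closed_subgraph K -> connected K -> (#|sverts K| <= #|sedges K|.+1)%N.
Proof.
move=> clK conK; have [nzK _] := conK; have [v vK] := set0Pn _ nzK.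
have := card_sverts_outside clK conK (W := [set v]).
rewrite sub1set vK -card_gt0 cards1 => /(_ isT isT).
have := cardsD1 v (sverts K); rewrite vK => -> le.
rewrite add1n ltnS; apply: leq_trans le _; apply: subset_leq_card.
by apply/subsetP=> x; rewrite inE => /andP[].
Qed.

(** Trees are encoded by their Euler characteristic instead of by acyclicity: counting is all that
    the genus formulas use, and it survives subdivision. *)
Definition is_tree : Prop :=
  connected (full_subgraph G) /\ #|vert G| = #|edge G|.+1.

Lemma full_closed : closed_subgraph (full_subgraph G).
Proof. by move=> e _; rewrite !inE. Qed.

(** Connectedness bounds the vertices of [H] from above. Growing [H] to the whole tree costs one
    edge outside [H] per vertex outside [H], which bounds them from below. *)
Lemma card_sverts_subtree H :
  is_tree -> closed_subgraph H -> connected H ->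
  #|sverts H| = #|sedges H|.+1.
Proof.
move=> [conG cardG] clH conH; apply/eqP; rewrite eqn_leq.
rewrite card_sverts_connected //=.
have := card_sverts_outside full_closed conG (subsetT (sverts H)) conH.1.
rewrite setTD; set B := [set x in _ | _] => le.
have sB : B \subset ~: sedges H.
  by apply/subsetP=> x; rewrite !inE /=; apply: contra => /clH[-> ->].
have := leq_trans le (subset_leq_card sB).
have := cardsC (sverts H); have := cardsC (sedges H); lia.
Qed.

Lemma n_comp_connected H :
  closed_subgraph H -> connected H -> n_comp (adj H) (sverts H) = 1%N.
Proof.
move=> clH [nzH conH]; have [v vH] := set0Pn _ nzH.
rewrite -(n_comp_connect (connect_adj_sym H) v); apply: eq_n_comp_r => u.
apply/idP/idP => [uH|]; first exact: conH.
exact: connect_sverts.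
Qed.

Lemma component_closed H v : closed_subgraph H -> closed_subgraph (component H v).
Proof.
move=> clH x; rewrite !inE => /andP[xH /andP[sxH vsx]]; rewrite sxH vsx.
have [_ ->] := clH x xH; split=> //=.
exact: connect_trans vsx (connect1 (adj_src_tgt xH)).
Qed.

Lemma mem_component_edge H v x :
  closed_subgraph H -> x \in sedges H ->
  (src x \in sverts (component H v)) = (tgt x \in sverts (component H v)).
Proof.
move=> clH xH; rewrite !inE; have [-> ->] := clH x xH => /=.
rewrite -(same_connect_r (connect_adj_sym H) (connect1 (adj_src_tgt xH))).
by [].
Qed.

(** A component is cut out by paths in [H]; the point is that such a path uses only edges of the
    component itself. *)
Lemma component_connected H v :
  closed_subgraph H -> v \in sverts H -> connected (component H v).
Proof.
move=> clH vH; split.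
  by apply/set0Pn; exists v; rewrite inE vH connect0.
suff main u : u \in sverts (component H v) -> connect (adj (component H v)) v u.
  move=> u w /main vu /main; apply: connect_trans.
  by rewrite connect_adj_sym.
rewrite inE => /andP[uH vu].
(* An edge of [H] with an end in [W] belongs to the component, so its other end is in [W] too: no
   edge of [H] crosses the boundary of [W]. *)
pose W := [set w | connect (adj (component H v)) v w].
suff : u \in W by rewrite inE.
apply: contraT => uW; have vW : v \in W by rewrite inE connect0.
have [x xH] := crossing_edge vu vW uW; have [sxH txH] := clH x xH.
have WC w : w \in W -> w \in sverts (component H v).
  rewrite inE => vw; apply: connect_sverts vw; first exact: component_closed.
  by rewrite inE vH connect0.
have xC : (src x \in W) || (tgt x \in W) -> x \in sedges (component H v).
  move=> xW; have : src x \in sverts (component H v).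
    by case/orP: xW => /WC //; rewrite mem_component_edge.
  by rewrite /= !inE xH => ->.
have tW : tgt x \in W = (src x \in W).
  apply/idP/idP => xW; rewrite inE; move: (xW); rewrite inE => /connect_trans; apply;
    apply: connect1; last by apply: adj_src_tgt; rewrite xC ?xW.
  by rewrite adj_sym; apply: adj_src_tgt; rewrite xC ?xW ?orbT.
by rewrite tW eqxx.
Qed.

Lemma sum_incid W x :
  (\sum_(v in W) incid x v = (src x \in W) + (tgt x \in W))%N.
Proof.
by rewrite big_split /= !sum_eq_mem.
Qed.

Lemma genus_connected H :
  closed_subgraph H -> connected H ->
  genus H + (#|sverts H|)%:Z
    = (#|sedges H|)%:Z + 1 + (\sum_(v in sverts H) vgenus v)%N%:Z.
Proof.
by move=> clH conH; rewrite /genus /betti1 n_comp_connected //; ring.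
Qed.

(** Genus zero reads vertices = edges + 1 + sum of vertex genera, and the bound for connected graphs
    forces that sum to vanish. *)
Lemma is_tree_genus0 :
  connected (full_subgraph G) -> genus (full_subgraph G) = 0 -> is_tree.
Proof.
move=> conG g0; split=> //.
have := genus_connected full_closed conG.
have := card_sverts_connected full_closed conG.
rewrite g0 /= !cardsT add0r; move: (\sum_(v in _) _)%N #|vert G| #|edge G| => s a b; lia.
Qed.

End Graphs.

(** * Degree counts on one side [A] of an edge of a subtree *)

Section Bridge.
Variables (T : graph) (H : subgraph T) (e : edge T) (v : vert T).
Hypotheses (treeT : is_tree T) (clH : closed_subgraph H) (conH : connected H).
Hypotheses (eH : e \in sedges H) (vH : v \in sverts H).

Local Notation A := (component (remove_edge H e) v).

Lemma remove_edge_closed : closed_subgraph (remove_edge H e).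
Proof. by move=> x; rewrite !inE => /andP[_ /clH]. Qed.

Lemma side_closed : closed_subgraph A.
Proof. exact/component_closed/remove_edge_closed. Qed.

Lemma side_connected : connected A.
Proof. exact: (component_connected remove_edge_closed). Qed.

Lemma card_side : #|sverts A| = #|sedges A|.+1.
Proof. exact: (card_sverts_subtree treeT side_closed side_connected). Qed.

Lemma side_sub u : u \in sverts A -> u \in sverts H.
Proof. by rewrite inE => /andP[]. Qed.

Lemma side_edge x : x \in sedges H -> x != e ->
  (src x \in sverts A) = (tgt x \in sverts A).
Proof.
move=> xH xe; apply: (mem_component_edge _ remove_edge_closed).
by rewrite !inE xe.
Qed.

Lemma side_edgeE x : (x \in sedges A) = [&& x \in sedges H, x != e & src x \in sverts A].
Proof. by rewrite !inE; case: (x != e); rewrite ?andbF. Qed.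

(** If [A] had all vertices of [H], it would be a subtree with as many vertices as [H] but without
    the edge [e], against the Euler count. So some edge of [H] leaves [A], and only [e] can. *)
Lemma bridge_end : (src e \in sverts A) != (tgt e \in sverts A).
Proof.
have vA : v \in sverts A by rewrite inE vH connect0.
have [u uH uA] : exists2 u, u \in sverts H & u \notin sverts A.
  apply/subsetPn/negP => sHA.
  have := subset_leq_card sHA; rewrite card_side.
  have sAH : sedges A \subset sedges H :\ e.
    by apply/subsetP=> x; rewrite side_edgeE !inE => /and3P[-> ->].
  have := subset_leq_card sAH; have := cardsD1 e (sedges H); rewrite eH.
  have := card_sverts_subtree treeT clH conH; lia.
have [x xH] := crossing_edge (conH.2 v u vH uH) vA uA.
by have [-> //|/(side_edge xH)->] := eqVneq x e; rewrite eqxx.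
Qed.

Lemma bridge_ends : ((src e \in sverts A) + (tgt e \in sverts A) = 1)%N.
Proof. by move: bridge_end; do 2!case: (_ \in _). Qed.

(** Edges of [A] are counted at both ends, and [e] at its single end in [A]. *)
Lemma sum_valence_side :
  (\sum_(u in sverts A) valence H u = 2 * #|sedges A| + 1)%N.
Proof.
rewrite exchange_big /=; under eq_bigr do rewrite sum_incid.
rewrite (bigD1 e) //= bridge_ends addnC; congr (_ + _)%N.
rewrite mulnC -sum_nat_const [RHS]big_mkcond [LHS]big_mkcond /=.
apply: eq_bigr => x _; rewrite side_edgeE.
case xH: (x \in sedges H); case xe: (x != e) => //=.
by rewrite -(side_edge xH xe); case: ifP.
Qed.

Variables (R : realType) (len : edge T -> R) (f : vert T -> R).

(** Discrete divergence theorem: slopes along edges inside [A] cancel, leaving the slope along [e]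
    directed away from [A]. *)
Lemma sum_div_side :
  \sum_(u in sverts A) div len f H u
  = ((src e \in sverts A)%:R - (tgt e \in sverts A)%:R) * slope len f e.
Proof.
rewrite exchange_big /=.
have sum_eq w : \sum_(u in sverts A) (w == u)%:R = (w \in sverts A)%:R :> R.
  by rewrite -natr_sum sum_eq_mem.
under eq_bigr do rewrite -mulr_suml sumrB !sum_eq.
rewrite (bigD1 e) //= big1 ?addr0 // => x /andP[xH xe].
by rewrite (side_edge xH xe) subrr mul0r.
Qed.

Variables (ram : pred (edge T)) (br : vert T -> nat).

(** The number b of branch points on [A], with the cut ramified edges outside [H]. As [e] lies in
    [H], it is not counted here even if ramified. *)
Definition side_branch : nat :=
  (\sum_(u in sverts A)
     (br u + \sum_(x | (x \notin sedges H) && ram x) incid x u))%N.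

(** The terms [valence - 2] add up to -1 on [A], by the Euler count for the tree [A] and the extra
    half-edge of [e]. *)
Lemma sum_divisor_side :
  \sum_(u in sverts A) (Dprime R ram br H u + div len f H u)
  = side_branch%:R / 2 - 1
    + ((src e \in sverts A)%:R - (tgt e \in sverts A)%:R) * slope len f e.
Proof.
rewrite big_split /= sum_div_side; congr (_ + _).
rewrite big_split /= sumrB -natr_sum sum_valence_side -mulr_suml.
rewrite sumr_const card_side -mulr_natr -natr_sum -/side_branch.
by rewrite -[in RHS]/side_branch natrD natrM -natr1; ring.
Qed.

(** Passing from [H] to [A], the only new cut edge meeting [A] is [e]. The right side is the total
    branching of the cover restricted to [A], as it occurs in [RH_preim]. *)
Lemma side_branchE :
  (side_branch + ram e
   = \sum_(u in sverts A) br u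
     + \sum_(x | (x \notin sedges A) && ram x)
         ((src x \in sverts A) + (tgt x \in sverts A)))%N.
Proof.
rewrite /side_branch big_split /= -addnA; congr (_ + _)%N.
rewrite exchange_big /=; under eq_bigr do rewrite sum_incid.
rewrite [in LHS]big_mkcond [in RHS]big_mkcond /= (bigD1 e) //= eH /= add0n.
rewrite [RHS](bigD1 e) //= side_edgeE eqxx andbF /= bridge_ends addnC.
congr (_ + _)%N.
apply: eq_bigr => x xe; rewrite side_edgeE xe /=.
case xH: (x \in sedges H) => //=; rewrite -(side_edge xH xe).
by case: (_ \in _) => //=; case: ifP.
Qed.

End Bridge.

(** Removing [e] leaves exactly two sides, one for each end of [e]; two separated vertices lie on
    different ones. *)
Lemma side_separates (T : graph) (H : subgraph T) (e : edge T) (v w1 w2 : vert T) :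
  is_tree T -> closed_subgraph H -> connected H ->
  v \in sverts H -> w1 \in sverts H -> w2 \in sverts H -> between H e w1 w2 ->
  ((w1 \in sverts (component (remove_edge H e) v))
   + (w2 \in sverts (component (remove_edge H e) v)) = 1)%N.
Proof.
move=> treeT clH conH vH w1H w2H [eH w12].
set E := remove_edge H e in w12 *; have symE := connect_adj_sym E.
have [seH teH] := clH e eH.
have st w : w \in sverts H ->
    connect (adj E) w (src e) != connect (adj E) w (tgt e).
  by move=> wH; have := bridge_end treeT clH conH eH wH; rewrite !inE seH teH.
(* By [st] every vertex of [H] reaches exactly one end of [e], so reaching [src e] or not tells the
   two sides apart. *)
have conE w w' : w \in sverts H -> w' \in sverts H ->
    connect (adj E) w w'
    = (connect (adj E) w (src e) == connect (adj E) w' (src e)).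
  move=> wH w'H; apply/idP/eqP => [ww'|eq_s].
    exact: same_connect ww' _.
  case sw: (connect (adj E) w (src e)) in eq_s *.
    by apply: connect_trans sw _; rewrite symE -eq_s.
  have tw z : z \in sverts H -> connect (adj E) z (src e) = false ->
      connect (adj E) z (tgt e).
    by move=> zH sz; have := st z zH; rewrite sz; case: (connect _ _ _).
  by apply: connect_trans (tw _ wH sw) _; rewrite symE; apply: tw.
rewrite !inE w1H w2H /= (conE v w1) // (conE v w2) //; move: w12; rewrite (conE w1 w2) //.
by do 3!case: (connect _ _ _).
Qed.

(* [cov_ram u] is the number of smooth ramification points on the component u. *)
Record double_cover (G T : graph) := DoubleCover {
  covV : vert G -> vert T;
  covE : edge G -> edge T;
  cov_m : edge G -> nat;
  cov_deg : vert G -> nat;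
  cov_ram : vert G -> nat;
  covE_src : forall x, src (covE x) = covV (src x);
  covE_tgt : forall x, tgt (covE x) = covV (tgt x);
  cov_m_12 : forall x, cov_m x = 1%N \/ cov_m x = 2%N;
  cov_deg_gt0 : forall u, (0 < cov_deg u)%N;
  cov_deg_total : forall v, (\sum_(u | covV u == v) cov_deg u = 2)%N;
  cov_harmonic_src : forall u y, src y = covV u ->
    (\sum_(x | (covE x == y) && (src x == u)) cov_m x = cov_deg u)%N;
  cov_harmonic_tgt : forall u y, tgt y = covV u ->
    (\sum_(x | (covE x == y) && (tgt x == u)) cov_m x = cov_deg u)%N;
  cov_RH : forall u,
    (2 * vgenus u + 2 * cov_deg u
     = 2 + cov_ram u + \sum_x incid x u * (cov_m x).-1)%N
}.

(** * Double covers of graphs: Riemann-Hurwitz and connectedness of preimages *)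

Section DoubleCover.
Variables (G T : graph) (c : double_cover G T).
Implicit Types (u : vert G) (x : edge G) (v w : vert T) (y : edge T).

Definition cov_ramified y : bool :=
  [exists x, (covE c x == y) && (cov_m c x == 2%N)].

Definition cov_branch v : nat := (\sum_(u | covV c u == v) cov_ram c u)%N.

Local Notation preim := (preimage_subgraph (covV c) (covE c)).

(** Grouping the edges above [y] by source, harmonicity turns each group into the local degree of a
    vertex above [src y]. *)
Lemma cov_m_total y : (\sum_(x | covE c x == y) cov_m c x = 2)%N.
Proof.
rewrite -(cov_deg_total c (src y)).
rewrite (partition_big (fun x => src x) (fun u => covV c u == src y)) /=.
  by apply: eq_bigr => u /eqP uy; rewrite (cov_harmonic_src (esym uy)).
by move=> x /eqP <-; rewrite covE_src.
Qed.

Lemma cov_m_excess y :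
  (\sum_(x | covE c x == y) (cov_m c x).-1 = cov_ramified y)%N.
Proof.
have tot := cov_m_total y.
case ry: (cov_ramified y) => /=.
  case/existsP: ry => x0 /andP[x0y /eqP m0].
  move: tot; rewrite (bigD1 x0) //= m0 => /eqP; rewrite -{2}[2%N]addn0 eqn_add2l.
  rewrite sum_nat_eq0 => /forallP rest.
  rewrite (bigD1 x0) //= m0 big1 // => x xP.
  by have := rest x; rewrite xP => /eqP->.
apply: big1 => x xy; move/negbT: ry; rewrite negb_exists => /forallP/(_ x).
by rewrite xy /=; case: (cov_m_12 c x) => ->.
Qed.

Lemma card_cov_fiber y : (#|[set x | covE c x == y]| + cov_ramified y = 2)%N.
Proof.
rewrite -cov_m_excess -(cov_m_total y) -sum1dep_card -big_split /=.
by apply: eq_bigr => x _; case: (cov_m_12 c x) => ->.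
Qed.

Lemma card_sedges_preim A :
  (#|sedges (preim A)| + \sum_(y in sedges A) cov_ramified y
     = 2 * #|sedges A|)%N.
Proof.
rewrite -sum1_card (partition_big (covE c) (mem (sedges A))) /=; last first.
  by move=> x; rewrite inE.
rewrite -big_split mulnC -sum_nat_const /=; apply: eq_bigr => y yA.
rewrite -[RHS](card_cov_fiber y) -sum1dep_card; congr (_ + _)%N.
by apply: eq_bigl => x; rewrite inE; case: eqP => [->|]; rewrite ?yA ?andbF.
Qed.

(** The local Riemann-Hurwitz formula summed over all vertices above [A]. Ramified edges inside [A]
    contribute at both ends; those outside contribute once per end on [A], like branch points. *)
Lemma RH_preim A : closed_subgraph A ->
  (2 * \sum_(u in sverts (preim A)) vgenus u + 4 * #|sverts A|
   = 2 * #|sverts (preim A)| + \sum_(v in sverts A) cov_branch v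
     + 2 * \sum_(y in sedges A) cov_ramified y
     + \sum_(y | (y \notin sedges A) && cov_ramified y)
         ((src y \in sverts A) + (tgt y \in sverts A)))%N.
Proof.
move=> clA; set P := sverts (preim A).
have fib (F : vert G -> nat) : (\sum_(u in P) F u
    = \sum_(v in sverts A) \sum_(u | covV c u == v) F u)%N.
  rewrite (partition_big (covV c) (mem (sverts A))) /=; last first.
    by move=> u; rewrite inE.
  apply: eq_bigr => v vA; apply: eq_bigl => u.
  by rewrite inE; case: eqP => [->|]; rewrite ?vA ?andbF.
have degP : (\sum_(u in P) cov_deg c u = 2 * #|sverts A|)%N.
  rewrite fib mulnC -sum_nat_const; apply: eq_bigr => v _.
  exact: cov_deg_total.
have edges : (\sum_(u in P) \sum_x incid x u * (cov_m c x).-1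
    = 2 * \sum_(y in sedges A) cov_ramified y
     + \sum_(y | (y \notin sedges A) && cov_ramified y)
         ((src y \in sverts A) + (tgt y \in sverts A)))%N.
  rewrite exchange_big /=.
  under eq_bigr do rewrite -big_distrl /= sum_incid !inE -covE_src -covE_tgt.
  rewrite (partition_big (covE c) predT) //=.
  under eq_bigr => y _.
    under eq_bigr => x /eqP-> do over.
    rewrite -big_distrr /= cov_m_excess; over.
  rewrite (bigID (mem (sedges A))) /=; congr (_ + _)%N.
    rewrite big_distrr /=; apply: eq_bigr => y /clA[-> ->].
    by rewrite addn1.
  rewrite [RHS]big_mkcondr /=; apply: eq_bigr => y _.
  by case: (cov_ramified y); rewrite ?muln1 ?muln0.
have : (\sum_(u in P) (2 * vgenus u + 2 * cov_deg c u)
   = \sum_(u in P) (2 + cov_ram c u + \sum_x incid x u * (cov_m c x).-1))%N.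
  by apply: eq_bigr => u _; rewrite cov_RH.
set cut := (\sum_(y | (y \notin _) && _) _)%N in edges *.
rewrite !big_split /= !big1_eq degP edges sum_nat_const.
have -> : (\sum_(v in sverts A) cov_branch v = \sum_(u in P) cov_ram c u)%N.
  by rewrite fib.
lia.
Qed.

(** Edges lift from any vertex above an end: the local degree there is positive and is a sum over
    the edges above, so that sum is not empty. *)
Lemma lift_path A u w :
  connect (adj A) (covV c u) w ->
  exists2 u', covV c u' = w & connect (adj (preim A)) u u'.
Proof.
case/connectP=> p; elim: p u => [|v p IHp] u /=.
  by move=> _ ->; exists u.
case/andP=> /existsP[y /andP[yA uv]] pth wE.
have [u1 u1v uu1] : exists2 u1, covV c u1 = v & adj (preim A) u u1.
  case/orP: uv => /andP[/eqP y1 /eqP y2].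
    have := cov_deg_gt0 c u; rewrite -(cov_harmonic_src y1).
    case: (pickP (fun x => (covE c x == y) && (src x == u))) => [x|e0].
      case/andP=> /eqP xy /eqP xu _; exists (tgt x).
        by rewrite -covE_tgt xy.
      by apply/existsP; exists x; rewrite inE xy yA xu !eqxx.
    by rewrite big_pred0.
  have := cov_deg_gt0 c u; rewrite -(cov_harmonic_tgt y2).
  case: (pickP (fun x => (covE c x == y) && (tgt x == u))) => [x|e0].
    case/andP=> /eqP xy /eqP xu _; exists (src x).
      by rewrite -covE_src xy.
    by apply/existsP; exists x; rewrite inE xy yA xu !eqxx orbT.
  by rewrite big_pred0.
rewrite -u1v in pth wE; have [u' u'w u1u'] := IHp _ pth wE.
by exists u' => //; apply: connect_trans (connect1 uu1) u1u'.
Qed.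

Lemma push_path A u u' :
  connect (adj (preim A)) u u' -> connect (adj A) (covV c u) (covV c u').
Proof.
case/connectP=> p; elim: p u => [|v p IHp] u /=; first by move=> _ ->.
case/andP=> /existsP[x /andP[xA uv]] pth u'E.
apply: connect_trans (IHp _ pth u'E); apply: connect1.
apply/existsP; exists (covE c x); rewrite inE in xA; rewrite xA covE_src covE_tgt.
by case/orP: uv => /andP[/eqP-> /eqP->]; rewrite !eqxx ?orbT.
Qed.

(** An end of an edge of order 2 has local degree at least 2, which exhausts the total degree over
    its image. *)
Lemma ramified_end_inj y v u u' :
  cov_ramified y -> src y = v \/ tgt y = v ->
  covV c u = v -> covV c u' = v -> u = u'.
Proof.
case/existsP=> x0 /andP[/eqP x0y /eqP m0] yv.
have [u0 u0v d0] : exists2 u0, covV c u0 = v & (2 <= cov_deg c u0)%N.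
  case: yv => yv.
    exists (src x0); first by rewrite -covE_src x0y.
    rewrite -(cov_harmonic_src (y := y)) -?x0y ?covE_src //.
    by rewrite (bigD1 x0) /= ?eqxx // m0 leq_addr.
  exists (tgt x0); first by rewrite -covE_tgt x0y.
  rewrite -(cov_harmonic_tgt (y := y)) -?x0y ?covE_tgt //.
  by rewrite (bigD1 x0) /= ?eqxx // m0 leq_addr.
have uniq1 z : covV c z = v -> z = u0.
  move=> zv; apply/eqP; apply: contraT => zu0.
  have := cov_deg_total c v; rewrite (bigD1 u0) ?u0v ?eqxx //=.
  rewrite (bigD1 z) ?zv ?eqxx //=; have := cov_deg_gt0 c z; lia.
by move=> /uniq1-> /uniq1->.
Qed.

Section Side.
Variables (H : subgraph T) (e : edge T).
Hypotheses (treeT : is_tree T) (clH : closed_subgraph H) (conH : connected H).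
Hypothesis eH : e \in sedges H.

(** All other terms of [RH_preim] are even, so the total branching over [A] is even; by
    [side_branchE] it is the number below. *)
Lemma side_branch_parity v : v \in sverts H ->
  ~~ odd (side_branch H e v cov_ramified cov_branch + cov_ramified e).
Proof.
move=> vH; rewrite (side_branchE treeT clH conH eH vH).
have := RH_preim (side_closed (e := e) (v := v) clH); lia.
Qed.

(** Ramification of [e] makes the preimage of [A] connected, so it is the whole component. With
    total branching 3 + 1 = 4, the Euler counts and [RH_preim] leave genus 1. *)
Lemma genus_side u :
  covV c u \in sverts H -> cov_ramified e ->
  side_branch H e (covV c u) cov_ramified cov_branch = 3%N ->
  genus (component (preim (remove_edge H e)) u) = 1.
Proof.
move=> uH re b3; set K := component _ u; set A := component (remove_edge H e) (covV c u).
have clRe := remove_edge_closed (e := e) clH.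
have clP : closed_subgraph (preim (remove_edge H e)).
  move=> x xP; have := clRe (covE c x); rewrite covE_src covE_tgt.
  by rewrite inE in xP; move=> /(_ xP)[]; rewrite ![_ \in sverts (preim _)]inE.
have uP : u \in sverts (preim (remove_edge H e)) by rewrite inE.
(* [a] is the end of [e] in [A]; only one vertex lies above it, and paths from [u] and from any [z]
   above [A] lift to paths ending there. *)
have [a [aA ae]] : exists a, a \in sverts A /\ (src e = a \/ tgt e = a).
  have := bridge_end treeT clH conH eH uH; rewrite -/A.
  have [sA _|_ tA] := boolP (src e \in sverts A).
    by exists (src e); split; auto.
  by exists (tgt e); split; auto; case: (_ \in _) tA.
have KV : sverts K = sverts (preim A).
  apply/setP=> z; rewrite !inE; apply: andb_id2l => zH.
  apply/idP/idP => [/push_path//|uz].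
  have [z1 z1a zz1] : exists2 z1, covV c z1 = a
      & connect (adj (preim (remove_edge H e))) z z1.
    apply: lift_path; move: aA; rewrite inE => /andP[_]; apply: connect_trans.
    by rewrite connect_adj_sym.
  have [u1 u1a uu1] : exists2 u1, covV c u1 = a
      & connect (adj (preim (remove_edge H e))) u u1.
    by apply: lift_path; move: aA; rewrite inE => /andP[_].
  rewrite (ramified_end_inj re ae u1a z1a) in uu1.
  by apply: connect_trans uu1 _; rewrite connect_adj_sym.
have KE : sedges K = sedges (preim A).
  have KEdef x : (x \in sedges K)
      = (covE c x \in sedges (remove_edge H e)) && (src x \in sverts K).
    by rewrite inE; congr (_ && _); rewrite inE.
  have AEdef y : (y \in sedges A)
      = (y \in sedges (remove_edge H e)) && (src y \in sverts A) by rewrite inE.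
  apply/setP=> x; rewrite KEdef KV [in RHS]inE AEdef covE_src.
  by rewrite [_ \in sverts (preim A)]inE.
have := genus_connected (component_closed (v := u) clP) (component_connected clP uP).
rewrite -/K KV KE.
have := RH_preim (side_closed (e := e) (v := covV c u) clH); rewrite -/A.
have := card_sedges_preim A; have := card_side e treeT clH uH; rewrite -/A.
have := side_branchE treeT clH conH eH uH cov_ramified cov_branch; rewrite b3 re -/A.
lia.
Qed.

End Side.
End DoubleCover.

(** * Subdividing trees and the double covers above them *)

Section SdNodes.
Variables (T : graph) (n : edge T -> nat).
Local Notation node := (sd_node n).

Lemma sd_node_inner y (k : 'I_(n y)) :
  node y k.+1 = inr (existT (fun y => 'I_(n y)) y k).
Proof.
rewrite /sd_node; case: insubP => [j _ jk|]; last by rewrite ltn_ord.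
by congr (inr (existT _ _ _)); apply: val_inj.
Qed.

Lemma sd_node_last y : node y (n y).+1 = inl (tgt y).
Proof. by rewrite /sd_node insubN // ltnn. Qed.

Lemma sd_nodeP y i : (i <= (n y).+1)%N ->
  [\/ i = 0%N, i = (n y).+1 | exists k : 'I_(n y), i = k.+1].
Proof.
case: i => [|i]; first by constructor 1.
rewrite ltnS leq_eqVlt => /orP[/eqP->|lt_i]; first by constructor 2.
by constructor 3; exists (Ordinal lt_i).
Qed.

Lemma sd_node_eq_inl y i v : (i <= (n y).+1)%N ->
  (node y i == inl v)
  = (i == 0%N) && (src y == v) || (i == (n y).+1) && (tgt y == v).
Proof.
case/sd_nodeP=> [->|->|[k ->]]; first by rewrite /= orbF.
  by rewrite sd_node_last eqxx.
by rewrite sd_node_inner eqSS (ltn_eqF (ltn_ord k)).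
Qed.

Lemma sd_node_eq_inr y i y' (k : 'I_(n y')) : (i <= (n y).+1)%N ->
  (node y i == inr (existT (fun y => 'I_(n y)) y' k))
  = (y == y') && (i == k.+1).
Proof.
case/sd_nodeP=> [->|->|[j ->]]; first by rewrite andbF.
  rewrite sd_node_last; apply/esym/negP => /andP[/eqP yy /eqP[nk]].
  by have := ltn_ord k; rewrite -nk yy ltnn.
rewrite sd_node_inner (inj_eq inr_inj); have [yy|yy] := eqVneq y y'.
  by case: y' / yy k => k /=; rewrite eq_Tagged.
by apply/eqP => -[yy' _]; rewrite yy' eqxx in yy.
Qed.

Lemma card_sd_vert : #|vert (sd_graph n)| = (#|vert T| + \sum_y n y)%N.
Proof.
rewrite card_sum card_tagged sumnE big_map big_enum /=; congr (_ + _)%N.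
by apply: eq_bigr => y _; rewrite card_ord.
Qed.

Lemma card_sd_edge : #|edge (sd_graph n)| = (#|edge T| + \sum_y n y)%N.
Proof.
rewrite card_tagged sumnE big_map big_enum /= -sum1_card -big_split /=.
by apply: eq_bigr => y _; rewrite card_ord.
Qed.

Lemma sd_node_connect y i : (i <= (n y).+1)%N ->
  connect (adj (full_subgraph (sd_graph n))) (inl (src y)) (node y i).
Proof.
elim: i => [|i IHi] le_i //=; apply: connect_trans (IHi (ltnW le_i)) _.
apply: connect1; apply/existsP.
exists (existT (fun y => 'I_(n y).+1) y (Ordinal le_i)).
by rewrite inE /= !eqxx.
Qed.

(** Each new point adds one vertex and one edge, and every old edge becomes a path. *)
Lemma sd_is_tree : is_tree T -> is_tree (sd_graph n).
Proof.
move=> [[nzT conT] cardT]; split; last by rewrite card_sd_vert card_sd_edge cardT.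
have [v0 _] := set0Pn _ nzT; split; first by apply/set0Pn; exists (inl v0).
set E := adj _.
have inl_con u v : connect E (inl u) (inl v).
  have /connectP[p] := conT u v (in_setT _) (in_setT _).
  elim: p u => [|w p IHp] u /=; first by move=> _ ->.
  case/andP=> /existsP[y /andP[_ uw]] pth vE.
  apply: connect_trans (IHp _ pth vE).
  have := sd_node_connect (leqnn (n y).+1); rewrite sd_node_last -/E.
  by case/orP: uw => /andP[/eqP-> /eqP->] //; rewrite connect_adj_sym.
have v0_con z : connect E (inl v0) z.
  case: z => [v|[y k]]; first exact: inl_con.
  apply: connect_trans (inl_con v0 (src y)) _.
  by rewrite -sd_node_inner; apply: sd_node_connect; apply: leqW.
move=> u v _ _; apply: connect_trans (v0_con v).
by rewrite connect_adj_sym.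
Qed.

End SdNodes.

(** Each edge above [e] carries exactly one item over the item [k] of [e]. This reduces sums over
    the subdivision to sums over the original cover, both for new vertices and for pieces of
    edges. *)
Lemma sum_fiber_sigT (E' E : finType) (f : E' -> E) (N : E -> nat) (e : E)
    (k : 'I_(N e)) (F : E' -> nat) (Q : pred {e' : E' & 'I_(N (f e'))})
    (Q' : pred E') :
  (forall e' (j : 'I_(N (f e'))), f e' = e -> j = k :> nat ->
     Q (existT (fun e' => 'I_(N (f e'))) e' j) = Q' e') ->
  (\sum_(z | (existT (fun e => 'I_(N e)) (f (tag z)) (tagged z)
              == existT (fun e => 'I_(N e)) e k) && Q z) F (tag z)
   = \sum_(e' | (f e' == e) && Q' e') F e')%N.
Proof.
move=> QQ'.
rewrite (partition_big (fun z => tag z) (fun e' => (f e' == e) && Q' e')) /=; last first.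
  move=> [e' j] /andP[/eqP ej Qz] /=.
  have fe : f e' = e := congr1 (fun z => tag z) ej.
  have jk : j = k :> nat := congr1 (fun z : {e & 'I_(N e)} => nat_of_ord (tagged z)) ej.
  by rewrite fe eqxx -(QQ' e' j fe jk).
apply: eq_bigr => e' /andP[/eqP fe Qe']; case: e / fe k QQ' => k QQ'.
rewrite (big_pred1 (existT (fun e' => 'I_(N (f e'))) e' k)) //= => -[e2 j] /=.
have [e2E|ne] := eqVneq e2 e'; last first.
  by rewrite andbF; apply/esym/eqP => -[e2E _]; rewrite e2E eqxx in ne.
rewrite andbT; move: j; rewrite e2E => j; rewrite !eq_Tagged /=.
by have [->|//] := eqVneq j k; rewrite (QQ' e' k erefl erefl) Qe'.
Qed.

Local Arguments sd_node : simpl never.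

Section SdCover.
Variables (G T : graph) (c : double_cover G T) (n : edge T -> nat).
Local Notation nG := (fun x : edge G => n (covE c x)).
Local Notation sG := (sd_graph nG).
Local Notation sT := (sd_graph n).
Local Notation mapV := (@sd_mapV G T (covV c) (covE c) n).
Local Notation mapE := (@sd_mapE G T (covE c) n).

Definition sd_cov_deg (u : vert sG) : nat :=
  match u with inl u => cov_deg c u | inr z => cov_m c (tag z) end.
Definition sd_cov_ram (u : vert sG) : nat :=
  if u is inl u then cov_ram c u else 0%N.
Definition sd_cov_m (x : edge sG) : nat := cov_m c (tag x).

Lemma sd_node_map x i : (i <= (n (covE c x)).+1)%N ->
  sd_node n (covE c x) i = mapV (sd_node nG x i).
Proof.
case/sd_nodeP=> [->|->|[k ->]]; first by rewrite /sd_node /= covE_src.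
  by rewrite sd_node_last (sd_node_last nG) /= covE_tgt.
by rewrite sd_node_inner (sd_node_inner (n := nG)).
Qed.

Lemma sd_src x : src (mapE x) = mapV (src x).
Proof. by case: x => x i; apply: sd_node_map; apply: ltnW. Qed.

Lemma sd_tgt x : tgt (mapE x) = mapV (tgt x).
Proof. by case: x => x i; apply: sd_node_map. Qed.

Lemma sd_cov_deg_gt0 u : (0 < sd_cov_deg u)%N.
Proof.
case: u => [u|[x k]] /=; first exact: cov_deg_gt0.
by case: (cov_m_12 c x) => ->.
Qed.

Lemma sd_cov_deg_total v : (\sum_(u | mapV u == v) sd_cov_deg u = 2)%N.
Proof.
rewrite big_sumType /=; case: v => [v|[y k]].
  rewrite [X in (_ + X)%N]big_pred0 => [|[x j] //].
  by rewrite addn0; exact: cov_deg_total.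
rewrite big_pred0 // add0n -[RHS](cov_m_total c y).
have := @sum_fiber_sigT _ _ (covE c) n y k (cov_m c) predT predT (fun _ _ _ _ => erefl).
under [X in _ = X -> _]eq_bigl do rewrite andbT.
by move=> <-; apply: eq_bigl => -[x j]; rewrite andbT.
Qed.

(** At an old vertex only first pieces start, and the original harmonicity applies; at a new vertex
    a single piece starts, of the order of its edge. *)
Lemma sd_harmonic_src u y : src y = mapV u ->
  (\sum_(x | (mapE x == y) && (src x == u)) sd_cov_m x = sd_cov_deg u)%N.
Proof.
case: y => y i /= yu.
have le_i : (i <= (n y).+1)%N by apply: ltnW.
case: u yu => [u|[x0 k]] /= /eqP.
  rewrite sd_node_eq_inl // (ltn_eqF (ltn_ord i)) orbF => /andP[/eqP i0 /eqP yu].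
  rewrite -(cov_harmonic_src yu).
  apply: (@sum_fiber_sigT _ _ (covE c) (fun y => (n y).+1)).
  move=> x j _ ji; rewrite (sd_node_eq_inl (n := nG)) ?(ltnW (ltn_ord j)) //.
  by rewrite ji i0 orbF.
rewrite sd_node_eq_inr // => /andP[/eqP yx /eqP ik].
transitivity (\sum_(x | (covE c x == y) && (x == x0)) cov_m c x)%N; last first.
  rewrite (big_pred1 x0) // => x /=.
  by have [->|] := eqVneq x x0; rewrite ?andbF // -yx eqxx.
apply: (@sum_fiber_sigT _ _ (covE c) (fun y => (n y).+1)).
move=> x j _ ji; rewrite (sd_node_eq_inr (n := nG)) ?(ltnW (ltn_ord j)) //.
by rewrite ji ik eqxx andbT.
Qed.

Lemma sd_harmonic_tgt u y : tgt y = mapV u ->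
  (\sum_(x | (mapE x == y) && (tgt x == u)) sd_cov_m x = sd_cov_deg u)%N.
Proof.
case: y => y i yu.
have le_i : (i.+1 <= (n y).+1)%N by [].
case: u yu => [u|[x0 k]] /eqP.
  rewrite sd_node_eq_inl //= => /andP[/eqP[i_n] /eqP yu].
  rewrite -(cov_harmonic_tgt yu).
  apply: (@sum_fiber_sigT _ _ (covE c) (fun y => (n y).+1)).
  move=> x j xy ji; rewrite /= (sd_node_eq_inl (n := nG)) //=.
  by rewrite ji i_n xy eqxx.
rewrite sd_node_eq_inr //= => /andP[/eqP yx /eqP[ik]].
transitivity (\sum_(x | (covE c x == y) && (x == x0)) cov_m c x)%N; last first.
  rewrite (big_pred1 x0) // => x /=.
  by have [->|] := eqVneq x x0; rewrite ?andbF // -yx eqxx.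
apply: (@sum_fiber_sigT _ _ (covE c) (fun y => (n y).+1)).
move=> x j _ ji; rewrite /= (sd_node_eq_inr (n := nG)) //.
by rewrite ji ik eqxx andbT.
Qed.

(** At a new vertex, of genus 0 and on an edge of order m, the formula reads 2m = 2 + 2(m - 1). *)
Lemma sd_RH u :
  (2 * vgenus u + 2 * sd_cov_deg u
   = 2 + sd_cov_ram u + \sum_x incid x u * (sd_cov_m x).-1)%N.
Proof.
have sumE (H : graph) (u' : vert H) (m : edge H -> nat) :
    (\sum_x incid x u' * m x
      = \sum_(x | src x == u') m x + \sum_(x | tgt x == u') m x)%N.
  under eq_bigr do rewrite mulnDl; rewrite big_split /=.
  by congr (_ + _)%N; rewrite [RHS]big_mkcond; apply: eq_bigr => x _;
    case: eqP; rewrite ?mul1n.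
rewrite sumE; case: u => [u|[x0 k]] /=.
  rewrite cov_RH sumE; congr (_ + (_ + _))%N.
    (* Pieces starting at an old vertex are the first pieces of edges starting there; below, those
       ending there are last pieces. *)
    rewrite (reindex_onto (fun x => existT (fun x => 'I_(n (covE c x)).+1) x ord0)
      (fun z => tag z)) /=.
      apply: eq_bigl => x; rewrite eqxx andbT.
      by rewrite (sd_node_eq_inl (n := nG)) // orbF.
    move=> [x j] /=; rewrite (sd_node_eq_inl (n := nG)) ?(ltnW (ltn_ord j)) //.
    rewrite (ltn_eqF (ltn_ord j)) orbF => /andP[/eqP j0 _].
    by congr existT; apply: val_inj.
  rewrite (reindex_onto (fun x => existT (fun x => 'I_(n (covE c x)).+1) x ord_max)
    (fun z => tag z)) /=.
    apply: eq_bigl => x; rewrite eqxx andbT.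
    by rewrite (sd_node_eq_inl (n := nG)) //= eqxx.
  move=> [x j]; rewrite /= (sd_node_eq_inl (n := nG)) //=.
  by rewrite eqSS => /andP[/eqP j0 _]; congr existT; apply: val_inj.
(* The new vertex [k] is node [k.+1] of its edge: piece [k.+1] leaves it and piece [k] arrives. *)
rewrite (big_pred1 (existT (fun x => 'I_(n (covE c x)).+1) x0 (lift ord0 k))); last first.
  move=> [x j] /=; rewrite (sd_node_eq_inr (n := nG)) ?(ltnW (ltn_ord j)) //.
  have [xE|ne] := eqVneq x x0; last first.
    by apply/esym/eqP => -[xE _]; rewrite xE eqxx in ne.
  by move: j; rewrite xE => j; rewrite eq_Tagged.
rewrite (big_pred1 (existT (fun x => 'I_(n (covE c x)).+1) x0
  (widen_ord (leqnSn _) k))); last first.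
  move=> [x j]; rewrite /= (sd_node_eq_inr (n := nG)) //.
  have [xE|ne] := eqVneq x x0; last first.
    by apply/esym/eqP => -[xE _]; rewrite xE eqxx in ne.
  by move: j; rewrite xE => j; rewrite eq_Tagged eqSS.
by rewrite /sd_cov_m /=; case: (cov_m_12 c x0) => ->.
Qed.

(** The original cover and its subdivision thus share one interface, so the results on sides apply
    to both. *)
Definition sd_cover : double_cover sG sT :=
  @DoubleCover sG sT mapV mapE sd_cov_m sd_cov_deg sd_cov_ram sd_src sd_tgt
    (fun x => cov_m_12 c (tag x))
    sd_cov_deg_gt0 sd_cov_deg_total sd_harmonic_src sd_harmonic_tgt sd_RH.
End SdCover.

(** * Images of subgraphs under a double cover *)

Section CoverImage.
Variables (G T : graph) (c : double_cover G T) (K : subgraph G).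
Local Notation im := (image_subgraph (covV c) (covE c)).

Lemma image_closed : closed_subgraph K -> closed_subgraph (im K).
Proof.
move=> clK y /imsetP[x /clK[sx tx] ->].
by rewrite covE_src covE_tgt; split; apply: imset_f.
Qed.

Lemma image_connected : connected K -> connected (im K).
Proof.
move=> [nzK conK]; split.
  by have [u uK] := set0Pn _ nzK; apply/set0Pn; exists (covV c u); apply: imset_f.
move=> _ _ /imsetP[u uK ->] /imsetP[u' u'K ->]; apply: push_path.
apply: connect_sub (conK u u' uK u'K) => w w' /existsP[x /andP[xK ww']].
by apply: connect1; apply/existsP; exists x; rewrite inE imset_f.
Qed.

End CoverImage.

(** * Slopes of a maximum of affine functions *)

Section AffineMax.
Variables (R : realType) (I : finType) (b s : I -> R).

Lemma bigmax0_attained (F : I -> R) :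
  \big[Num.max/0]_i F i = 0 \/ exists i, \big[Num.max/0]_i F i = F i.
Proof.
apply: (big_ind (fun z => z = 0 \/ exists i, z = F i)); first by left.
  by move=> y z hy hz; rewrite maxEle; case: ifP.
by move=> i _; right; exists i.
Qed.

(** A member attaining the maximum at the midpoint lies below it at both ends; two affine functions
    touching this way have equal slopes. *)
Lemma affine_max_slope (l r a k : R) : l < r ->
  (forall t, l <= t <= r -> \big[Num.max/0]_i (b i + s i * t) = k + a * t) ->
  a = 0 \/ exists i, a = s i.
Proof.
move=> lr affine.
have tangent a' k' : k' + a' * ((l + r) / 2) = k + a * ((l + r) / 2) ->
    k' + a' * l <= k + a * l -> k' + a' * r <= k + a * r -> a = a'.
  move=> em el er; have : (a - a') * (r - l) = 0 by lra.
  by move/eqP; rewrite mulf_eq0 => /orP[/eqP|/eqP]; lra.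
have il : l <= l <= r by lra.
have ir : l <= r <= r by lra.
have im : l <= (l + r) / 2 <= r by lra.
have [e0|[i ei]] := bigmax0_attained (fun i => b i + s i * ((l + r) / 2)).
  left; apply: (tangent 0 0); rewrite ?mul0r ?addr0 -?affine ?e0 //.
    exact: bigmax_ge_id.
  exact: bigmax_ge_id.
right; exists i; apply: (tangent (s i) (b i)); rewrite -?affine ?ei //.
  exact: (le_bigmax _ (fun i => b i + s i * l)).
exact: (le_bigmax _ (fun i => b i + s i * r)).
Qed.

End AffineMax.

(** * Invariants of the subdivided cover and a parity obstruction *)

Section SdCoverInvariants.
Variables (G T : graph) (c : double_cover G T) (n : edge T -> nat).

Lemma sd_cov_ramified y :
  cov_ramified (sd_cover c n) y = cov_ramified c (tag y).
Proof.
case: y => y k /=; apply/existsP/existsP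
  => [[[x j] /andP[/eqP xy m2]]|[x /andP[/eqP xy m2]]].
  exists x; rewrite [cov_m c x == _]m2 andbT.
  by apply/eqP; exact: (congr1 (fun z => tag z) xy).
case: y / xy k => k.
by exists (existT (fun x => 'I_(n (covE c x)).+1) x k); rewrite eqxx.
Qed.

Lemma sd_cov_branch v :
  cov_branch (sd_cover c n) v = if v is inl v then cov_branch c v else 0%N.
Proof.
rewrite /cov_branch big_sumType /= [X in (_ + X)%N]big1 ?addn0 //.
by case: v => [v|z] //; rewrite big_pred0.
Qed.

End SdCoverInvariants.

Lemma eq_side_branch (T : graph) (H : subgraph T) e v ram ram' br br' :
  ram =1 ram' -> br =1 br' ->
  side_branch H e v ram br = side_branch H e v ram' br'.
Proof.
move=> eram ebr; apply: eq_bigr => u _; rewrite ebr; congr (_ + _)%N.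
by apply: eq_bigl => x; rewrite eram.
Qed.

(** Clearing denominators gives 3 - b = ±(2z + r), so b + r would be odd. *)
Lemma half_degree_slope_neq (R : realType) (b : nat) (r : bool) (z : int)
    (eps : R) :
  ~~ odd (b + r) -> eps = 1 \/ eps = -1 ->
  1 / 2 <> b%:R / 2 - 1 + eps * (z%:~R + r%:R / 2).
Proof.
move=> parity eps1 deg_eq.
have : (3 - b%:Z)%:~R = (2 * z + r)%:~R :> R
    \/ (3 - b%:Z)%:~R = (- (2 * z + r))%:~R :> R.
  rewrite !rmorphN !rmorphD rmorphM rmorphN /= -!pmulrn.
  by case: eps1 deg_eq => ->; [left|right]; lra.
by case=> /eqP; rewrite eqr_int => /eqP; case: r parity {deg_eq} => /=; lia.
Qed.

(** * Slopes of admissible functions and of their maximum with zero *)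

Section AdmissibleCover.
Variables (R : realType) (X : admissible_cover R).

Definition cover : double_cover (Gam X) (Tree X) :=
  @DoubleCover (Gam X) (Tree X) (@cV R X) (@cE R X) (@cmE R X) (@cdeg R X)
    (fun u => #|[set i | cram X i == u]|)
    (@cE_src R X) (@cE_tgt R X) (@cmE_12 R X) (@cdeg_gt0 R X) (@cdeg_total R X)
    (@harmonic_src R X) (@harmonic_tgt R X) (@Riemann_Hurwitz R X).

Lemma cover_branch v : cov_branch cover v = branch_deg v.
Proof.
rewrite /branch_deg -sum1dep_card.
rewrite (partition_big (cram X) (fun u => cV u == v)) //=.
apply: eq_bigr => u /eqP uv; rewrite /= -sum1dep_card.
by apply: eq_bigl => i; have [->|] := eqVneq (cram X i) u; rewrite ?andbF // -uv eqxx.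
Qed.

Lemma Tree_is_tree : is_tree (Tree X).
Proof. exact: is_tree_genus0 (Tree_connected X) (Tree_genus X). Qed.

(** The side of [src y] in the whole tree has integral degree k, that of [v0]. Hence the slope away
    from it is k + 1 - b/2, where b has the parity of the ramification of [y]. *)
Lemma admissible_slope v0 f (y : edge (Tree X)) : is_admissible v0 f ->
  exists z : int, slope (@lenT R X) f y = z%:~R + (ramified y)%:R / 2.
Proof.
case=> _ adm; have treeX := Tree_is_tree.
pose F := full_subgraph (Tree X).
have clF : closed_subgraph F := @full_closed _.
have conF : connected F := treeX.1.
have yF : y \in sedges F by rewrite inE.
have sF : src y \in sverts F by rewrite inE.
set A := component (remove_edge F y) (src y).
have sA : src y \in sverts A by rewrite inE sF connect0.
have tA : tgt y \in sverts A = false.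
  by have := bridge_end treeX clF conF yF sF; rewrite -/A sA; case: (_ \in _).
have := sum_divisor_side treeX clF conF yF sF (@lenT R X) f
  (@ramified R X) (@branch_deg R X).
under eq_bigr do rewrite adm.
rewrite -/A sA tA subr0 mul1r -natr_sum.
set k := (\sum_(v in _) _)%N.
rewrite -(eq_side_branch F y (src y) (frefl (@ramified R X)) cover_branch).
have := side_branch_parity cover treeX clF conF yF sF.
rewrite -[cov_ramified cover]/(@ramified R X); set b := side_branch _ _ _ _ _.
move=> parity eq_k; exists (k%:Z + 1 - (b + ramified y)./2%:Z).
have bE : (b + ramified y)%:R = 2 * ((b + ramified y)./2)%:R :> R.
  rewrite -natrM mul2n; congr (_%:R).
  by have := odd_double_half (b + ramified y); rewrite (negPf parity).
move: bE; rewrite natrD !rmorphD rmorphN /= -!pmulrn => bE.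
lra.
Qed.

Variables (lam : vert (Tree X) -> vert (Tree X) -> R) (S : subdivision X).

(** The vertex and edge formulas agree at both ends of [y], since each function is interpolated
    linearly along [y]. *)
Lemma sd_lamT_node y i : (i <= (sd_n S y).+1)%N ->
  sd_lamT (S := S) lam (sd_node (@sd_n R X S) y i) = lamT_edge lam y (knot S y i).
Proof.
case/sd_nodeP=> [->|->|[k ->]].
- by rewrite /= /lamT_vert /lamT_edge; apply: eq_bigr => v _; rewrite mulr0 addr0.
- rewrite sd_node_last /= /knot /knot_of insubN ?ltnn // /lamT_vert /lamT_edge.
  apply: eq_bigr => v _; rewrite /slope divfK ?gt_eqF ?lenT_gt0 //.
  by rewrite addrC subrK.
rewrite sd_node_inner /= /knot /knot_of.
case: insubP => [j _ jk|]; last by rewrite ltn_ord.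
by congr (lamT_edge _ _ (sd_pos _)); apply: val_inj.
Qed.

Lemma sd_lamT_slope y : lamT_linear lam S ->
  slope (@sd_len R X S) (sd_lamT lam (S := S)) y = 0
  \/ exists v0, slope (@sd_len R X S) (sd_lamT lam (S := S)) y
                = slope (@lenT R X) (lam v0) (tag y).
Proof.
move=> fine; have [a [k lin]] := fine y; have lt_y := ltn_ord (tagged y).
have lr : sd_left y < sd_right y by apply: sd_incr; rewrite -ltnS.
suff -> : slope (@sd_len R X S) (sd_lamT lam (S := S)) y = a.
  exact: (affine_max_slope lr lin).
have l_in : sd_left y <= sd_left y <= sd_right y by rewrite lexx ltW.
have r_in : sd_left y <= sd_right y <= sd_right y by rewrite lexx ltW.
have src_val : sd_lamT lam (src y) = k + a * sd_left y.
  by rewrite -lin // -sd_lamT_node // ltnW.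
have tgt_val : sd_lamT lam (tgt y) = k + a * sd_right y.
  by rewrite -lin // -sd_lamT_node.
rewrite /slope src_val tgt_val /sd_len.
field.
by rewrite subr_eq0 gt_eqF.
Qed.

End AdmissibleCover.

(** * Genus over the two sides of an edge between the points of D *)

Theorem corollary3p19 (R : realType) (X : admissible_cover R)
  (lam : vert (Tree X) -> vert (Tree X) -> R)
  (lam_admissible : forall v0, is_admissible v0 (lam v0))
  (lam_normalized : forall v0, is_normalized (lam v0))
  (S : subdivision X) (S_fine : lamT_linear lam S)
  (Delta : subgraph (sdG S)) (Delta_min : is_Delta lam Delta)
  (D1 D2 : vert (sdT S))
  (D1_in : D1 \in sverts (psi_image Delta))
  (D2_in : D2 \in sverts (psi_image Delta))
  (D1_neq_D2 : D1 <> D2)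
  (D_half : forall v, v \in sverts (psi_image Delta) ->
     divD lam (psi_image Delta) v = ((v == D1)%:R + (v == D2)%:R) / 2)
  (e : edge (sdT S)) (e_between : between (psi_image Delta) e D1 D2) :
  forall v, v \in sverts (psi_preimage (remove_edge (psi_image Delta) e)) ->
    genus (component (psi_preimage (remove_edge (psi_image Delta) e)) v) = 1.
Proof.
move=> u; rewrite inE => uH.
have [[clDelta conDelta _ _] _] := Delta_min.
pose c := sd_cover (cover X) (@sd_n R X S).
set H := psi_image Delta in D1_in D2_in D_half e_between uH *.
have treeT : is_tree (sdT S) := sd_is_tree (@sd_n R X S) (Tree_is_tree X).
have clH : closed_subgraph H := image_closed (c := c) clDelta.
have conH : connected H := image_connected c conDelta.
have eH := e_between.1.
set v := psiV u in uH; set A := component (remove_edge H e) v.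
(* Exactly one of [D1] and [D2] lies in [A], so D has degree 1/2 there. *)
have D_A := side_separates treeT clH conH uH D1_in D2_in e_between.
pose b := side_branch H e v (cov_ramified c) (cov_branch c).
have bE : b = side_branch H e v (@sd_ramified R X S) (@sd_branch_deg R X S).
  apply: eq_side_branch => [y|w]; first exact: sd_cov_ramified.
  by rewrite sd_cov_branch; case: w => // w; rewrite cover_branch.
have ends : ((src e \in sverts A) + (tgt e \in sverts A) = 1)%N :=
  bridge_ends treeT clH conH eH uH.
have parity := side_branch_parity c treeT clH conH eH uH; rewrite -/b in parity.
have := sum_divisor_side treeT clH conH eH uH (@sd_len R X S)
  (sd_lamT lam (S := S)) (@sd_ramified R X S) (@sd_branch_deg R X S).
rewrite -bE -/A.
have -> : \sum_(w in sverts A) (Dprime R (sd_ramified (S:=S)) (sd_branch_deg (S:=S)) H w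
    + div (sd_len (S:=S)) (sd_lamT lam (S:=S)) H w) = 1 / 2.
  transitivity (\sum_(w in sverts A) ((w == D1)%:R + (w == D2)%:R) / 2 : R).
    by apply: eq_bigr => w /side_sub; apply: D_half.
  rewrite -mulr_suml; congr (_ / _).
  have sum_eq z : (\sum_(w in sverts A) (w == z) = (z \in sverts A))%N.
    by rewrite -sum_eq_mem; apply: eq_bigr => w _; rewrite eq_sym.
  by rewrite big_split /= -!natr_sum !sum_eq -natrD D_A.
set sl := slope _ _ _; set eps := ((src e \in _)%:R - _) => deg_eq.
(* [eps] is 1 if [e] is oriented away from [A], and -1 otherwise. *)
have eps_cases : eps = 1 \/ eps = -1.
  rewrite /eps; case: (src e \in _) ends; case: (tgt e \in _) => //= _.
    by left; rewrite subr0.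
  by right; rewrite sub0r.
(* Once b is 3, [parity] makes [e] ramified and [genus_side] applies. *)
suff b3 : b = 3%N.
  have ram_e : cov_ramified c e.
    by move: parity; rewrite b3; case: (cov_ramified _ _).
  exact: (@genus_side _ _ c H e treeT clH conH eH u uH ram_e b3).
have [s0|[v0 sE]] := sd_lamT_slope e S_fine.
  have : b%:R = 3%:R :> R by move: deg_eq; rewrite /sl s0 mulr0; lra.
  by move/eqP; rewrite eqr_nat => /eqP.
(* A slope inherited from an admissible function has the wrong half-integrality for degree 1/2 on
   [A]. *)
have [z zE] := admissible_slope (tag e) (lam_admissible v0).
have ramE : cov_ramified c e = ramified (tag e) by rewrite /c sd_cov_ramified.
rewrite ramE in parity; rewrite /sl sE zE in deg_eq.
by case: (half_degree_slope_neq parity eps_cases deg_eq).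
Qed.
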